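(* Let $q$ be a prime power, let $s\ge1$ be an integer, let $F$ be a global function field with full constant field $\mathbb{F}_q$ and genus $g$, and let $P_\infty,P_1,\ldots,P_s$ be $s+1$ distinct places of $F$ with $\deg(P_\infty)=1$. Put $e_i=\deg(P_i)$ for $1\le i\le s$ and $v=\mathrm{lcm}(e_1,\ldots,e_s)$. Let $C^{(1)},\ldots,C^{(s)}\in\mathbb{F}_q^{\mathbb{N}\times\mathbb{N}_0}$ be the generating matrices given by the refined columnwise construction (described in the context). Then for all $1\le i\le s$ and all $d\in\mathbb{N}$, the length of the $d$th row of $C^{(i)}$ is at most $$g+sv\left\lfloor\frac{d-1}{v}\right\rfloor+iv.$$
   Context: **Row length.** The length of a row $(c_0,c_1,\ldots)\in\mathbb{F}_q^{\mathbb{N}_0}$ with only finitely many nonzero entries is $\max\{l\in\mathbb{N}:c_{l-1}\ne0\}$, and it is $0$ if all $c_r=0$. (Part of the assertion is that each row has only finitely many nonzero entries.) Rows are numbered $1,2,\ldots$ and columns $0,1,\ldots$. **Refined columnwise construction.** For a divisor $D$ of $F$ let $\mathcal{L}(D)=\{f\in F^*:\mathrm{div}(f)+D\ge 0\}\cup\{0\}$ be the Riemann-Roch space and $\ell(D)$ its dimension over $\mathbb{F}_q$. The gap numbers of $P_\infty$ are the $g$ positive integers $n$ with $\ell(nP_\infty)=\ell((n-1)P_\infty)$. Let $n_0<n_1<\cdots$ be the elements of $\mathbb{N}_0$ that are not gap numbers of $P_\infty$, in increasing order (so $n_r=r+g$ for $r\ge g$). Choose elements $y_r\in F$, $r\ge0$,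 as follows. - For $0\le r\le g$: any $y_r\in\mathcal{L}(n_rP_\infty)\setminus\mathcal{L}((n_r-1)P_\infty)$. - For $r>g$: determine integers $l_s,l_{s-1},\ldots,l_1\ge0$ by successive division with remainder: $w_{s+1}:=r-g$ and, for $i=s,s-1,\ldots,1$, $w_{i+1}=iv\,l_i+w_i$ with $w_i\in\{0,\ldots,iv-1\}$. Then choose any $y_r\in\mathcal{L}(D_r)\setminus\mathcal{L}(D_r')$, where $D_r=n_rP_\infty-\sum_{i=1}^s(l_i+l_{i+1}+\cdots+l_s)\frac{v}{e_i}P_i$ and $D_r'=n_{r-1}P_\infty-\sum_{i=1}^s(l_i+l_{i+1}+\cdots+l_s)\frac{v}{e_i}P_i$ (such a $y_r$ exists). For $1\le i\le s$ choose a local parameter $z_i$ at $P_i$ (i.e. $\nu_{P_i}(z_i)=1$) and write the local expansion of $y_r$ at $P_i$ as $y_r=\sum_{k=0}^\infty\beta^{(i)}_{k,r}z_i^k$ with $\beta^{(i)}_{k,r}\in\mathbb{F}_{q^{e_i}}$ (the residue class field of $P_i$; expansion in the completion of $F$ at $P_i$, identified with $\mathbb{F}_{q^{e_i}}((z_i))$). Using a fixed ordered basis of $\mathbb{F}_{q^{e_i}}/\mathbb{F}_q$, identify $\beta^{(i)}_{k,r}$ with a column vector $\boldsymbol{b}^{(i)}_{k,r}\in\mathbb{F}_q^{e_i}$. Column $r$ of $C^{(i)}=(c^{(i)}_{j,r})_{j\ge1,r\ge0}$ is the concatenation of $\boldsymbol{b}^{(i)}_{0,r},\boldsymbol{b}^{(i)}_{1,r},\ldots$;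 i.e. $c^{(i)}_{ke_i+h,r}$ is the $h$th coordinate of $\boldsymbol{b}^{(i)}_{k,r}$ for $k\ge0$, $1\le h\le e_i$. *)

(* Defs.v *)
(* MathComp, with mathcomp-classical for choice on places and multinomials'
   freeg for divisors. *)
From HB Require Import structures.
From mathcomp Require Import all_boot all_order all_algebra all_field.
From mathcomp Require Import ring_quotient fraction generic_quotient.
From mathcomp Require Import boolp classical_sets.
From mathcomp.multinomials Require Import freeg.

Set Implicit Arguments.
Unset Strict Implicit.
Unset Printing Implicit Defensive.

Import Order.TTheory GRing.Theory Num.Theory.
Local Open Scope ring_scope.
Local Open Scope quotient_scope.

(* Normalized discrete valuations.  The value oo at 0 is not represented:
   v 0 is set to 0 (so that v is determined by its nonzero arguments),
   and inequalities n <= v x are always stated through [vge], true at x = 0. *)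
Record dval (K : fieldType) := DVal {
  dval_fun :> K -> int;
  dval0 : dval_fun 0 = 0;
  dvalM : forall x y, x != 0 -> y != 0 ->
    dval_fun (x * y) = dval_fun x + dval_fun y;
  dvalD : forall x y, x != 0 -> y != 0 -> x + y != 0 ->
    Num.min (dval_fun x) (dval_fun y) <= dval_fun (x + y);
  dval_norm : exists2 x, x != 0 & dval_fun x = 1
}.

Definition vge (K : fieldType) (v : dval K) (n : int) : {pred K} :=
  [pred x | (x == 0) || (n <= v x)].

Section ValuationRing.
Variables (K : fieldType) (v : dval K).

Lemma dval1 : v 1 = 0.
Proof.
have := dvalM v (oner_neq0 K) (oner_neq0 K).
by rewrite mulr1 => /eqP; rewrite -subr_eq0 opprD addNKr oppr_eq0 => /eqP.
Qed.

Lemma dvalN x : v (- x) = v x.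
Proof.
have [->|x0] := eqVneq x 0; first by rewrite oppr0.
have n10 : -1 != 0 :> K by rewrite oppr_eq0 oner_eq0.
have h : v (-1) = 0.
  have := dvalM v n10 n10; rewrite mulrNN mulr1 dval1 => /eqP.
  by rewrite eq_sym -mulr2n mulrn_eq0 /= => /eqP.
by rewrite -mulN1r dvalM // h add0r.
Qed.

Lemma vgeD n x y : x \in vge v n -> y \in vge v n -> x + y \in vge v n.
Proof.
rewrite !inE; have [->|x0] := eqVneq x 0; first by rewrite add0r.
have [->|y0] := eqVneq y 0; first by rewrite addr0 (negPf x0).
have [//|xy0] := eqVneq (x + y) 0 => /= hx hy.
by apply: (le_trans _ (dvalD v x0 y0 xy0)); rewrite le_min hx.
Qed.

Lemma vgeN n x : x \in vge v n -> - x \in vge v n.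
Proof. by rewrite !inE oppr_eq0 dvalN. Qed.

Lemma vgeM m n x y :
  x \in vge v m -> y \in vge v n -> x * y \in vge v (m + n).
Proof.
rewrite !inE mulf_eq0; have [//|x0] := eqVneq x 0.
by have [//|y0] := eqVneq y 0 => /= hx hy; rewrite dvalM // lerD.
Qed.

Definition valring : {pred K} := vge v 0.

Fact valring_subring : subring_closed valring.
Proof.
split=> [|x y hx hy|x y hx hy]; first by rewrite inE dval1 lexx orbT.
  by apply: vgeD => //; apply: vgeN.
by have := vgeM hx hy; rewrite addr0.
Qed.
HB.instance Definition _ := GRing.isSubringClosed.Build K valring valring_subring.

Record valring_type := ValRing { vr_val :> K; _ : vr_val \in valring }.
HB.instance Definition _ := [isSub for vr_val].
HB.instance Definition _ := [Choice of valring_type by <:].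
HB.instance Definition _ := [SubChoice_isSubComNzRing of valring_type by <:].

Definition maxideal : {pred valring_type} :=
  [pred x : valring_type | vr_val x \in vge v 1].

Fact maxideal_idealr : idealr_closed maxideal.
Proof.
split=> [|| a x y hx hy]; first by rewrite !inE eqxx.
  by rewrite !inE oner_eq0 dval1.
rewrite inE /=; apply: vgeD => //.
by have := vgeM (valP a) hx; rewrite add0r.
Qed.
HB.instance Definition _ := isIdealr.Build valring_type maxideal maxideal_idealr.

Definition residue_field : comNzRingType := {ideal_quot maxideal}.

(* Residue class of an element of the valuation ring; the value is 0 outside
   the valuation ring. *)
Definition residue (x : K) : residue_field :=
  \pi_({ideal_quot maxideal}) (insubd (0 : valring_type) x).

Definition vcvg (u : nat -> K) (x : K) :=
  forall n : int, exists N : nat, forall m, (N <= m)%N -> u m - x \in vge v n.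

Definition vcauchy (u : nat -> K) :=
  forall n : int, exists N : nat, forall m m', (N <= m)%N -> (N <= m')%N ->
    u m - u m' \in vge v n.

End ValuationRing.

(* Completion of (K, v): a complete discretely valued field extending (K, v) in
   which K is dense.  It is unique up to unique isomorphism. *)
Record completion (K : fieldType) (v : dval K) := Completion {
  cfield :> fieldType;
  cval : dval cfield;
  cemb : {rmorphism K -> cfield};
  cval_ext : forall x, cval (cemb x) = v x;
  cval_dense : forall (x : cfield) (n : int),
    exists f, x - cemb f \in vge cval n;
  cval_complete : forall u : nat -> cfield,
    vcauchy cval u -> exists x, vcvg cval u x
}.

(* The elements b_0, ..., b_{n-1} form a basis of the k-subspace U of R, where
   k acts on R by multiplication through h : k -> R. *)
Definition is_basis (k : fieldType) (R : comNzRingType) (h : k -> R)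
    (U : set R) (n : nat) (b : 'I_n -> R) : Prop :=
  (forall i, U (b i)) /\
  (forall x, U x -> exists! a : {ffun 'I_n -> k}, x = \sum_i h (a i) * b i).

(* The dimension of U (0 if it is infinite). *)
Definition dimension (k : fieldType) (R : comNzRingType) (h : k -> R)
    (U : set R) : nat :=
  xget 0%N [set n | exists b : 'I_n -> R, is_basis h U b]%classic.

Section FunctionField.
(* An algebraic function field of one variable over k is a finite extension of
   a rational function field k(x). *)
Variables (k : fieldType) (F : fieldExtType {fraction {poly k}}).

Definition constant : {rmorphism k -> F} :=
  (in_alg F \o @tofrac {poly k} \o polyC).

Definition full_constant_field : Prop :=
  forall f : F, algebraicOver constant f -> exists c, f = constant c.

(* The places of F / k, given by their normalized discrete valuations.  By
   [dval0] and extensionality, distinct places have valuations that differ at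
   some nonzero element. *)
Record place := Place {
  place_val :> dval F;
  place_constant : forall c, c != 0 -> place_val (constant c) = 0
}.
HB.instance Definition _ := gen_eqMixin place.
HB.instance Definition _ := gen_choiceMixin place.

Definition residue_constant (P : place) (c : k) : residue_field P :=
  residue P (constant c).

Definition place_deg (P : place) : nat :=
  dimension (residue_constant P) setT.

Definition divisor := {freeg place / int}.

Definition divisor_deg (D : divisor) : int :=
  \sum_(P <- dom D) coeff P D * (place_deg P)%:Z.

(* The valuation of div(f) + D at P is P f + coeff P D. *)
Definition RRspace (D : divisor) : set F :=
  [set f | f = 0 \/ forall P : place, 0 <= P f + coeff P D]%classic.

Definition ell (D : divisor) : nat := dimension constant (RRspace D).

Definition is_genus (g : nat) : Prop :=
  (forall A : divisor, divisor_deg A - (ell A)%:Z + 1 <= g%:Z) /\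
  (exists A : divisor, divisor_deg A - (ell A)%:Z + 1 = g%:Z).

Definition gap_number (P : place) (n : nat) : Prop :=
  (0 < n)%N /\ ell << n%:Z *g P >> = ell << n%:Z - 1 *g P >>.

Definition nongap_enumeration (P : place) (n_ : nat -> nat) : Prop :=
  (forall r r', (r < r')%N -> (n_ r < n_ r')%N) /\
  (forall m, (exists r, n_ r = m) <-> ~ gap_number P m).

(* For a completion E of F at P, the map tau embeds the residue class field as
   a field of representatives containing k; together with a local parameter z
   it identifies E with the field of Laurent series in z. *)
Definition coefficient_field (P : place) (E : completion P)
    (tau : {rmorphism residue_field P -> E}) : Prop :=
  (forall c, tau (residue_constant P c) = cemb E (constant c)) /\
  (forall f, f \in valring P -> tau (residue P f) - cemb E f \in vge (cval E) 1).

Definition local_expansion (P : place) (E : completion P)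
    (tau : {rmorphism residue_field P -> E}) (z f : F)
    (beta : nat -> residue_field P) : Prop :=
  vcvg (cval E) (fun m => \sum_(j < m) tau (beta j) * cemb E z ^+ j)
    (cemb E f).

(* [digit v t n i] is l_i in the successive division of w_{t+1} = n:
   w_{j+1} = j v l_j + w_j with 0 <= w_j < j v, for j = t, t-1, ..., 1. *)
Fixpoint digit (v t n i : nat) : nat :=
  if t is t'.+1 then
    if i == t then (n %/ (t * v))%N else digit v t' (n %% (t * v)) i
  else 0%N.

Section Construction.
(* The place P_i, for 1 <= i <= s, is [P i'] with i'.+1 = i. *)
Variables (s : nat) (Pinf : place) (P : 'I_s -> place).

Definition lcm_deg : nat := \big[lcmn/1%N]_(i < s) place_deg (P i).

(* m Pinf - sum_i (l_i + ... + l_s) (v / e_i) P_i, the l_j being those of r *)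
Definition choice_divisor (g r : nat) (m : nat) : divisor :=
  << m%:Z *g Pinf >> -
  \sum_(i < s) << ((\sum_(i.+1 <= j < s.+1) digit lcm_deg s (r - g) j) *
                    (lcm_deg %/ place_deg (P i)))%N%:Z *g P i >>.

Definition admissible_choice (g : nat) (n_ : nat -> nat) (y : nat -> F) : Prop :=
  (forall r, (r <= g)%N ->
     RRspace << (n_ r)%:Z *g Pinf >> (y r) /\
     ~ RRspace << (n_ r)%:Z - 1 *g Pinf >> (y r)) /\
  (forall r, (g < r)%N ->
     RRspace (choice_divisor g r (n_ r)) (y r) /\
     ~ RRspace (choice_divisor g r (n_ r.-1)) (y r)).

(* C^(i) is [C i'] with i'.+1 = i; its rows are numbered from 1, row 0 of the
   function being meaningless.  Coordinates h are numbered from 0 here. *)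
Definition refined_columnwise (g : nat) (C : 'I_s -> nat -> nat -> k) : Prop :=
  exists (n_ : nat -> nat) (y : nat -> F),
    [/\ nongap_enumeration Pinf n_, admissible_choice g n_ y &
      forall i : 'I_s,
        exists (E : completion (P i)) (tau : {rmorphism residue_field (P i) -> E})
               (z : F) (beta : nat -> nat -> residue_field (P i))
               (B : 'I_(place_deg (P i)) -> residue_field (P i)),
          [/\ coefficient_field tau,
              z != 0 /\ P i z = 1,
              forall r, local_expansion tau z (y r) (beta ^~ r),
              is_basis (residue_constant (P i)) setT B &
              forall j r, beta j r =
                \sum_(h < place_deg (P i)) residue_constant (P i)
                  (C i (j * place_deg (P i) + h.+1)%N r) * B h]].
End Construction.
End FunctionField.

(* [row_length c L]: the row c has finitely many nonzero entries and length L. *)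
Definition row_length (k : fieldType) (c : nat -> k) (L : nat) : Prop :=
  (L = 0%N /\ forall r, c r = 0) \/
  [/\ (0 < L)%N, c L.-1 != 0 &
      forall l, (0 < l)%N -> c l.-1 != 0 -> (l <= L)%N].

(* Main.v *)
(* If [l_i + ... + l_s > (d - 1) / v], then the divisor [D_r] forces [y_r] to
   vanish at [P_i] to an order exceeding the exponent of [z_i] that row [d]
   records, so that the entry [(d, r)] is [0].  The digit condition holds as
   soon as [r - g >= s v m + i v] with [m = (d - 1) / v]: either [l_s > m], or
   [l_s = m] and the remainder, being at least [i v], makes one of
   [l_i, ..., l_(s-1)] positive. *)
Require Import Defs.
From HB Require Import structures.
From mathcomp Require Import all_boot all_order all_algebra all_field.
From mathcomp Require Import ring_quotient fraction generic_quotient.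
From mathcomp Require Import classical_sets.
From mathcomp.multinomials Require Import freeg.

Set Implicit Arguments.
Unset Strict Implicit.

Import Order.TTheory GRing.Theory Num.Theory.

Section ValuationFacts.
Local Open Scope ring_scope.
Local Open Scope quotient_scope.
Variables (K : fieldType) (v : dval K).

Lemma vge_le (m n : int) (x : K) : m <= n -> x \in vge v n -> x \in vge v m.
Proof.
by move=> mn; rewrite !inE => /orP[->//|nx]; rewrite (le_trans mn nx) orbT.
Qed.

Lemma vge_sum (I : Type) (r : seq I) (p : pred I) (f : I -> K) (n : int) :
  (forall i, p i -> f i \in vge v n) -> \sum_(i <- r | p i) f i \in vge v n.
Proof.
move=> hf; elim/big_ind: _ => [|x y|//]; first by rewrite inE eqxx.
exact: vgeD.
Qed.

Lemma dvalX (x : K) (n : nat) : x != 0 -> v (x ^+ n) = v x *+ n.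
Proof.
move=> x0; elim: n => [|n IHn]; first by rewrite expr0 dval1 mulr0n.
by rewrite exprS dvalM ?expf_neq0// IHn mulrS.
Qed.

Lemma residue_surj (b : residue_field v) :
  exists2 f, f \in valring v & b = residue v f.
Proof.
exists (vr_val (repr b)); first exact: valP.
by rewrite /residue (valKd (0 : valring_type v)) reprK.
Qed.

Lemma residue_eq0 (f : K) : f \in vge v 1 -> residue v f = 0.
Proof.
move=> f1; have f0 : f \in valring v by exact: vge_le f1.
rewrite /residue; set a := insubd _ _.
have aI : a - 0 \in @maxideal K v.
  by rewrite subr0 inE; have -> : vr_val a = f by exact: insubdK.
transitivity (\pi_({ideal_quot (@maxideal K v)}) 0); last exact: rmorph0.
by apply/eqP; rewrite -Quotient.idealrBE.
Qed.

End ValuationFacts.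

Section Digits.

Lemma sum_digitS (v t n i : nat) : i <= t.+1 ->
  \sum_(i <= j < t.+2) digit v t.+1 n j =
  (n %/ (t.+1 * v) + \sum_(i <= j < t.+1) digit v t (n %% (t.+1 * v)) j)%N.
Proof.
move=> it; rewrite big_nat_recr//= eqxx addnC; congr addn.
by apply: eq_big_nat => j /andP[_ jt] /=; rewrite ltn_eqF.
Qed.

(** Either the top division has a positive quotient, or its dividend passes unchanged to the next
    smaller divisor. The descent stops at index [i] at the latest, since [n] is at least [i * v]. *)
Lemma sum_digit_gt0 (v t n i : nat) : 0 < v -> 0 < i -> i <= t -> i * v <= n ->
  0 < \sum_(i <= j < t.+1) digit v t n j.
Proof.
move=> v0 i0; elim: t n => [|t IHt] n it ivn; first by case: i i0 it {ivn}.
rewrite sum_digitS// addn_gt0.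
have tv0 : 0 < t.+1 * v by rewrite muln_gt0.
have [tvn|ntv] := leqP (t.+1 * v) n; first by rewrite divn_gt0 ?tvn.
rewrite modn_small// IHt ?orbT// -ltnS ltnNge; apply: contraL ntv => ti.
by rewrite -leqNgt (leq_trans _ ivn)// leq_mul2r ti orbT.
Qed.

Lemma sum_digit_ge (v s n m i : nat) : 0 < v -> 0 < i -> i <= s ->
  s * v * m + i * v <= n -> m < \sum_(i <= j < s.+1) digit v s n j.
Proof.
case: s => [|s] v0 i0 is_ hn; first by case: i i0 is_ {hn}.
have sv0 : 0 < s.+1 * v by rewrite muln_gt0.
rewrite sum_digitS//.
have : m <= n %/ (s.+1 * v).
  by rewrite leq_divRL// mulnC (leq_trans _ hn)// leq_addr.
rewrite leq_eqVlt => /orP[/eqP hm|mn]; last exact: ltn_addr.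
have hr : i * v <= n %% (s.+1 * v).
  by move: hn; rewrite {1}(divn_eq n (s.+1 * v)) -hm mulnC leq_add2l.
rewrite -hm -[ltnLHS]addn0 ltn_add2l sum_digit_gt0//.
(* If [i] were the top index, the remainder would be both at least and less than the top divisor. *)
rewrite -ltnS ltnNge; apply/negP => si.
have := leq_ltn_trans hr (ltn_pmod n sv0).
by rewrite ltnNge leq_mul2r si orbT.
Qed.

End Digits.

Section FunctionField.
Local Open Scope ring_scope.
Variables (k : fieldType) (F : fieldExtType {fraction {poly k}}).

Lemma residue_constant0 (P : place F) : residue_constant P 0 = 0.
Proof. by apply: residue_eq0; rewrite inE rmorph0 eqxx. Qed.

Lemma cval_vge (P : place F) (E : completion P) (n : int) (f : F) :
  (cemb E f \in vge (cval E) n) = (f \in vge P n).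
Proof. by rewrite !inE fmorph_eq0 cval_ext. Qed.

Section CoefficientField.
Variables (P : place F) (E : completion P).
Variable tau : {rmorphism residue_field P -> E}.
Hypothesis tauP : coefficient_field tau.

(** [tau b] differs from any integral lift of [b] by an element of the maximal ideal. This and the
    next lemma make every nonzero representative a unit. *)
Lemma coefficient_field_vge0 b : tau b \in vge (cval E) 0.
Proof.
have [f f0 ->] := residue_surj b.
rewrite -[tau _](subrK (cemb E f)); apply: vgeD; last by rewrite cval_vge.
by apply: vge_le (tauP.2 f f0).
Qed.

Lemma coefficient_field_eq0 b : tau b \in vge (cval E) 1 -> b = 0.
Proof.
have [f f0 ->] := residue_surj b => b1; apply: residue_eq0.
rewrite -(cval_vge E) -[cemb E f](subKr (tau (residue P f))).
by apply: vgeD => //; apply: vgeN; exact: tauP.2.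
Qed.

(** Strong induction on [j]: once the earlier coefficients vanish, the term of index [j] is the
    partial sum minus terms of higher order. Its valuation thus exceeds [j], which no unit
    coefficient allows. *)
Lemma local_expansion_eq0 (z f : F) (beta : nat -> residue_field P) (n j : nat) :
  z != 0 -> P z = 1 -> local_expansion tau z f beta -> f \in vge P n%:Z ->
  (j < n)%N -> beta j = 0.
Proof.
move=> z0 Pz hexp fn; elim/ltn_ind: j => j IHj jn.
have zX i : cemb E z ^+ i \in vge (cval E) i%:Z.
  by rewrite -rmorphXn cval_vge inE dvalX// Pz natz lexx orbT.
(* Past [N] the partial sum agrees with [f] to order [j.+1]; adding [j.+1] ensures that it contains
   the term of index [j]. *)
have [N /(_ (N + j.+1)%N (leq_addr _ _)) hN] := hexp j.+1%:Z.
have fj : cemb E f \in vge (cval E) j.+1%:Z by rewrite cval_vge; exact: vge_le fn.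
have := vgeD hN fj; rewrite subrK.
have jlt : (j < N + j.+1)%N by rewrite addnS ltnS leq_addl.
rewrite (bigD1 (Ordinal jlt))//= => hS.
set S := \sum_(i < _ | _) _ in hS.
have S1 : S \in vge (cval E) j.+1%:Z.
  apply: vge_sum => i ij; have [ltij|leji] := ltnP i j.
    by rewrite (IHj _ ltij (ltn_trans ltij jn)) rmorph0 mul0r inE eqxx.
  have ji : (j < i)%N by rewrite ltn_neqAle leji andbT eq_sym.
  apply: (@vge_le _ _ _ i); first by rewrite lez_nat.
  by have := vgeM (coefficient_field_vge0 (beta i)) (zX i); rewrite add0r.
have := vgeD hS (vgeN S1); rewrite addrK => hj.
have Ez0 : cemb E z != 0 by rewrite fmorph_eq0.
apply: coefficient_field_eq0; move: hj; rewrite !inE mulf_eq0 expf_eq0 (negPf Ez0).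
rewrite andbF orbF; have [//|b0 /=] := eqVneq (tau (beta j)) 0.
rewrite dvalM ?expf_neq0// dvalX// cval_ext Pz natz.
by rewrite -addn1 PoszD addrC lerD2r.
Qed.

End CoefficientField.

(** Distinctness of the places enters here: neither [Pinf] nor another [P j] contributes at
    [P i]. *)
Lemma coeff_choice_divisor (s : nat) (Pinf : place F) (P : 'I_s -> place F)
    (g r m : nat) (i : 'I_s) :
  injective P -> (forall j, P j <> Pinf) ->
  coeff (P i) (choice_divisor Pinf P g r m) =
  - ((\sum_(i.+1 <= j < s.+1) digit (lcm_deg P) s (r - g) j) *
     (lcm_deg P %/ place_deg (P i)))%N%:Z.
Proof.
move=> injP Pinf_neq; rewrite /choice_divisor coeffB coeffU.
have /negPf -> : Pinf != P i by apply/eqP => /esym; exact: Pinf_neq.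
rewrite mulr0 sub0r raddf_sum (bigD1 i)//= coeffU eqxx mulr1.
rewrite [X in _ + X]big1 ?addr0// => j ji; rewrite coeffU.
by rewrite (inj_eq injP) (negPf ji) mulr0.
Qed.

Lemma is_basis_eq0 (R : comNzRingType) (h : k -> R) (n : nat) (b : 'I_n -> R)
    (a : 'I_n -> k) :
  h 0 = 0 -> is_basis h setT b -> \sum_i h (a i) * b i = 0 ->
  forall i, a i = 0.
Proof.
move=> h0 [_ /(_ 0 I) [c [_ uc]]] ha i.
have ca : c = [ffun i => a i].
  by apply: uc; rewrite -[LHS]ha; apply: eq_bigr => j _; rewrite ffunE.
have c0 : c = [ffun=> 0].
  by apply: uc; rewrite big1// => j _; rewrite ffunE h0 mul0r.
have := congr1 (fun e : {ffun _} => e i) (etrans (esym ca) c0).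
by rewrite !ffunE.
Qed.

(** As [dimension] defaults to 0, a positive [place_deg] has to be read off an actual basis; an
    empty one would give 1 = 0. *)
Lemma is_basis_setT_gt0 (R : comNzRingType) (h : k -> R) (n : nat)
    (b : 'I_n -> R) : is_basis h setT b -> (0 < n)%N.
Proof.
case: n b => // b [_ /(_ 1 I) [a [/eqP + _]]].
by rewrite big_ord0 oner_eq0.
Qed.

Lemma row_length_exists (c : nat -> k) (M : nat) :
  (forall r, (M <= r)%N -> c r = 0) -> exists L, row_length c L /\ (L <= M)%N.
Proof.
elim: M => [|M IHM] cM.
  by exists 0%N; split=> //; left; split=> // r; exact: cM.
have [cM0|cM0] := eqVneq (c M) 0.
  have [|L [cL LM]] := IHM; last by exists L; split=> //; exact: leqW.
  by move=> r; rewrite leq_eqVlt => /orP[/eqP<-//|]; exact: cM.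
exists M.+1; split=> //; right; split=> // -[//|l] _ /=.
by rewrite ltnS leqNgt; apply: contra_neqN => /cM.
Qed.

Lemma refined_columnwise_eq0 (g s : nat) (Pinf : place F) (P : 'I_s -> place F)
    (C : 'I_s -> nat -> nat -> k) (i : 'I_s) (d r : nat) :
  injective P -> (forall j, P j <> Pinf) -> refined_columnwise Pinf P g C ->
  (0 < d)%N ->
  (g + s * lcm_deg P * ((d - 1) %/ lcm_deg P) + i.+1 * lcm_deg P <= r)%N ->
  C i d r = 0.
Proof.
move=> injP Pinf_neq [n_ [y [_ [_ hy] hC]]] d0; set v := lcm_deg P => hr.
have e0 j : (0 < place_deg (P j))%N.
  by have [E [tau [z [beta [B [_ _ _ /is_basis_setT_gt0]]]]]] := hC j.
have v0 : (0 < v)%N.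
  by rewrite /v /lcm_deg; elim/big_ind: _ => // a b a0 b0; rewrite lcmn_gt0 a0.
have [E [tau [z [beta [B [tauP [z0 Pz] hexp hB hbeta]]]]]] := hC i.
set e := place_deg (P i) in B hB hbeta.
have ev : (e %| v)%N by rewrite /v /lcm_deg (bigD1 i)//= dvdn_lcml.
(* Strictness comes from the positive summand [i.+1 * v]; it puts [r] in the range where
   [choice_divisor] governs [y r]. *)
have gr : (g < r)%N.
  apply: leq_trans hr.
  by rewrite -addnA -addn1 leq_add2l addn_gt0 orbC muln_gt0 v0.
have hd : ((d - 1) %/ v < \sum_(i.+1 <= j < s.+1) digit v s (r - g) j)%N.
  by apply: sum_digit_ge => //; rewrite leq_subRL ?(ltnW gr)// addnA.
set l := (\sum_(i.+1 <= j < s.+1) digit v s (r - g) j)%N in hd.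
have yr : y r \in vge (P i) (l * (v %/ e))%N%:Z.
  have [[->|yr] _] := hy r gr; first by rewrite inE eqxx.
  have := yr (P i); rewrite coeff_choice_divisor// subr_ge0 inE => ->.
  by rewrite orbT.
(* Row [d] records a coordinate of the coefficient of index [(d - 1) %/ e]. Since [e] divides [v],
   the bound amounts to [d - 1 < l * v]. *)
have jl : ((d - 1) %/ e < l * (v %/ e))%N.
  by rewrite ltn_divLR ?e0// -mulnA divnK// -ltn_divLR.
have beta0 := local_expansion_eq0 tauP z0 Pz (hexp r) yr jl.
(* The coordinate is number [(d - 1) %% e], counted from 0, because rows are counted from 1. *)
have he : ((d - 1) %% e < e)%N by rewrite ltn_mod e0.
have := is_basis_eq0 (residue_constant0 (P i)) hB
  (etrans (esym (hbeta _ r)) beta0) (Ordinal he).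
by rewrite /= addnS -divn_eq subn1 prednK.
Qed.

End FunctionField.

Theorem theorem2 (k : finFieldType) (F : fieldExtType {fraction {poly k}})
    (hF : full_constant_field F) (g : nat) (hg : is_genus F g)
    (s : nat) (hs : 0 < s)
    (Pinf : place F) (P : 'I_s -> place F)
    (hP : injective P) (hPinf : forall i, P i <> Pinf)
    (hdeg : place_deg Pinf = 1)
    (C : 'I_s -> nat -> nat -> k) (hC : refined_columnwise Pinf P g C) :
  let v := lcm_deg P in
  forall (i : 'I_s) (d : nat), 0 < d ->
    exists L : nat, row_length (C i d) L /\
      L <= g + s * v * ((d - 1) %/ v) + i.+1 * v.
Proof.
move=> v i d d0; apply: row_length_exists => r.
exact: refined_columnwise_eq0 hP hPinf hC d0.
Qed.
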